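(* Let $L_0=\{a^nb^n:n\ge0\}^*\subseteq\{a,b\}^*$ and let $h$ be the first/last/$ba$ morphism defined in the context. Then $(L_0,h)$ has exactly $7$ relative primes, exactly $34$ valid productions, and validity radius $3$: $$|\mathcal P_{L_0,h}|=7,\qquad |\mathcal V_{L_0,h}|=34,\qquad \rho(L_0,h)=3.$$
   Context: The morphism: $h(w)=(\mathrm{fst}(w),\mathrm{lst}(w),\mathrm{ba}(w))$ for $w\in\{a,b\}^*$, where $\mathrm{fst}(w),\mathrm{lst}(w)\in\{\bot,a,b\}$ are the first and last letters of $w$ ($\bot$ for the empty word) and $\mathrm{ba}(w)\in\{0,1\}$ records whether $w$ contains the factor $ba$. It is a morphism onto a finite monoid with the induced concatenation product. General definitions, for $L\subseteq\Sigma^*$ and a monoid morphism $h:\Sigma^*\to M$ into a finite monoid: $D_L(x)=\{(u,v):uxv\in L\}$; $x\equiv_L y$ iff $D_L(x)=D_L(y)$. The relative syntactic congruence $\theta$: $x\,\theta\,y$ iff $x\equiv_L y$ and $h(x)=h(y)$; its classes $[x]$ are called relative classes. A relative class is live if $D_L(x)\neq\varnothing$ for its members. The unit class is $[\varepsilon]$. For relative classes: $X\cdot Y=\{xy:x\in X,y\in Y\}$ and $X*Y=[xy]$ for any $x\in X,y\in Y$ (quotient product). A relative prime is a live relative class $P\ne[\varepsilon]$ such that whenever $P=X\cdot Y$ (equality of sets) for relative classes $X,Y$, one of $X,Y$ is $[\varepsilon]$; $\mathcal P_{L,h}$ is the set of relative primes. For $P\in\mathcal P_{L,h}$ and a sequence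 $\alpha=P_1\cdots P_k$ of relative primes with $k\ge2$, the production $P\to\alpha$ is correct if $P_1*\cdots*P_k=P$; $\alpha$ is pleonastic if some proper contiguous block of $\alpha$ of length $\ge2$ has quotient product a relative prime; a correct production is valid if its right-hand side is not pleonastic. $\mathcal V_{L,h}$ is the set of valid productions $(P,\alpha)$, and $\rho(L,h)$ is the supremum of the lengths $|\alpha|$ of right-hand sides of valid productions. *)

(* Defs.v *)
From HB Require Import structures.
From mathcomp Require Import all_boot all_order all_algebra.
From mathcomp Require Import boolp classical_sets cardinality constructive_ereal.

Set Implicit Arguments.
Unset Strict Implicit.
Unset Printing Implicit Defensive.

Local Open Scope classical_set_scope.

(* An alias of [seq] that carries the free monoid structure. *)
Definition word (A : Type) : Type := seq A.

HB.instance Definition _ (A : choiceType) := Choice.on (word A).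
HB.instance Definition _ (A : choiceType) :=
  isMonoid.Build (word A) (@catA A) (@cat0s A) (@cats0 A).

#[short(type="finMonoidType")]
HB.structure Definition FiniteMonoid := {M of Monoid M & Finite M}.

Section RelativeClasses.
Variables (A : finType) (M : finMonoidType).
Variables (L : set (word A)) (h : UMagmaMorphism.type (word A) M).

Definition contexts (x : word A) : set (word A * word A) :=
  [set uv | L (uv.1 ++ x ++ uv.2)].

Definition syneq (x y : word A) : Prop := contexts x = contexts y.

Definition releq (x y : word A) : Prop := syneq x y /\ h x = h y.

Definition relclass (x : word A) : set (word A) := [set y | releq x y].

Definition relclasses : set (set (word A)) := range relclass.

Definition unit_class : set (word A) := relclass [::].

Definition live (X : set (word A)) : Prop :=
  forall x, X x -> contexts x !=set0.

Definition setprod (X Y : set (word A)) : set (word A) :=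
  [set x ++ y | x in X & y in Y].

(* The class [xy] for any choice of x in X and y in Y; on relative classes it
   does not depend on the choice, see [quoprodE]. *)
Definition quoprod (X Y : set (word A)) : set (word A) :=
  [set z | exists x y, [/\ X x, Y y & releq (x ++ y) z]].

(* [unit_class] is neutral for [quoprod] on relative classes, so on a nonempty
   sequence of them this is P_1 * ... * P_k. *)
Definition quoprods (s : seq (set (word A))) : set (word A) :=
  foldr quoprod unit_class s.

Definition relprime (P : set (word A)) : Prop :=
  [/\ relclasses P, live P, P <> unit_class &
      forall X Y, relclasses X -> relclasses Y -> P = setprod X Y ->
        X = unit_class \/ Y = unit_class].

Definition relprimes : set (set (word A)) := [set P | relprime P].

Definition production : Type := (set (word A) * seq (set (word A)))%type.

Definition correct (p : production) : Prop :=
  [/\ relprime p.1, (forall Q, Q \in p.2 -> relprime Q), (2 <= size p.2)%N &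
      quoprods p.2 = p.1].

Definition pleonastic (s : seq (set (word A))) : Prop :=
  exists s1 s2 s3, [/\ s = s1 ++ s2 ++ s3, (2 <= size s2)%N,
    (size s2 < size s)%N & relprime (quoprods s2)].

Definition valid (p : production) : Prop := correct p /\ ~ pleonastic p.2.

Definition valid_productions : set production := [set p | valid p].

(* A supremum in the extended integers, where every nonempty set has one: it is
   [+oo] when the lengths are unbounded, and 0 when there is no valid
   production. *)
Definition validity_radius : \bar int :=
  supremum 0%E [set (Posz (size p.2))%:E | p in valid_productions].

Lemma relclass_eqP x y : relclass x = relclass y <-> releq x y.
Proof.
split=> [e|[exy hxy]].
  have : relclass y y by split.
  by rewrite -e.
by apply/seteqP; split=> z [e1 e2]; split;
  rewrite ?hxy -?e2 -?hxy // /syneq -?e1 ?exy // -exy.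
Qed.

Lemma releq_cat x x' y y' :
  releq x x' -> releq y y' -> releq (x ++ y) (x' ++ y').
Proof.
move=> [ex hx] [ey hy]; split; last first.
  by rewrite -[x ++ y]/(x * y)%g -[x' ++ y']/(x' * y')%g !gmulfM hx hy.
have cE u v : L (u ++ x ++ v) = L (u ++ x' ++ v).
  by have := congr1 (fun C => C (u, v)) ex.
have dE u v : L (u ++ y ++ v) = L (u ++ y' ++ v).
  by have := congr1 (fun C => C (u, v)) ey.
apply/seteqP; split=> -[u v]; rewrite /contexts /= -!catA.
  by rewrite cE catA dE -catA.
by rewrite -cE [u ++ _]catA -dE -catA.
Qed.

Lemma quoprodE x y : quoprod (relclass x) (relclass y) = relclass (x ++ y).
Proof.
apply/seteqP; split=> z.
  move=> [x' [y' [xx' yy' e]]].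
  by have /relclass_eqP -> : releq (x ++ y) (x' ++ y') by exact: releq_cat.
by move=> e; exists x, y; split=> //; split.
Qed.

End RelativeClasses.

Inductive letter : Set := a | b.

Definition letter_to_bool (x : letter) : bool := if x is b then true else false.
Definition bool_to_letter (x : bool) : letter := if x then b else a.

Lemma letter_to_boolK : cancel letter_to_bool bool_to_letter.
Proof. by case. Qed.

HB.instance Definition _ := Finite.copy letter (can_type letter_to_boolK).

Definition anbn : set (word letter) := [set nseq n a ++ nseq n b | n in setT].

Definition kleene_star (A : choiceType) (K : set (word A)) : set (word A) :=
  [set flatten s | s in [set s : seq (word A) | forall w, w \in s -> K w]].

Definition L0 : set (word letter) := kleene_star anbn.

Definition fst_letter (w : word letter) : option letter := ohead w.
Definition lst_letter (w : word letter) : option letter := ohead (rev w).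
Definition has_ba (w : word letter) : bool := infix [:: b; a] w.

Definition triple : Type := (option letter * option letter * bool)%type.

(* Not associative on all triples, hence the restriction to the image of
   w |-> (fst w, lst w, ba w), described by [attained]. *)
Definition triple_mul (t u : triple) : triple :=
  (if t.1.1 is Some _ then t.1.1 else u.1.1,
   if u.1.2 is Some _ then u.1.2 else t.1.2,
   [|| t.2, u.2 | (t.1.2 == Some b) && (u.1.1 == Some a)]).

Definition attained (t : triple) : bool :=
  match t with
  | (None, None, c) => ~~ c
  | (Some x, Some y, c) => c || ~~ ((x == b) && (y == a))
  | _ => false
  end.

Definition fstlstba : Type := {t : triple | attained t}.

HB.instance Definition _ := Finite.on fstlstba.

Lemma triple_mul_attained (t u : fstlstba) : attained (triple_mul (val t) (val u)).
Proof.
by case: t u => -[[[[]|] [[]|]] []] //= _ [[[[[]|] [[]|]] []] //= _].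
Qed.

Definition fstlstba_one : fstlstba := exist _ (None, None, false) isT.
Definition fstlstba_mul (t u : fstlstba) : fstlstba :=
  exist _ (triple_mul (val t) (val u)) (triple_mul_attained t u).

Lemma fstlstba_mulA : associative fstlstba_mul.
Proof.
move=> t u v; apply: val_inj => /=.
by case: t u v => -[[[[]|] [[]|]] []] //= _ [[[[[]|] [[]|]] []] //= _]
  [[[[[]|] [[]|]] []] //= _].
Qed.

Lemma fstlstba_mul1 : left_id fstlstba_one fstlstba_mul.
Proof. by move=> t; apply: val_inj; case: t => -[[[[]|] [[]|]] []]. Qed.

Lemma fstlstba_mulr1 : right_id fstlstba_one fstlstba_mul.
Proof. by move=> t; apply: val_inj; case: t => -[[[[]|] [[]|]] []]. Qed.

HB.instance Definition _ :=
  isMonoid.Build fstlstba fstlstba_mulA fstlstba_mul1 fstlstba_mulr1.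

Definition h_triple (w : word letter) : triple :=
  (fst_letter w, lst_letter w, has_ba w).

Lemma has_ba_cons x w :
  has_ba (x :: w) = ((x == b) && (fst_letter w == Some a)) || has_ba w.
Proof. by case: x; (case: w => [|[] w]); rewrite /has_ba //= prefix0s. Qed.

Lemma lst_letter_cons x w :
  lst_letter (x :: w) = if lst_letter w is Some y then Some y else Some x.
Proof.
by rewrite /lst_letter rev_cons; case: (rev w) => [|y s]; rewrite ?rcons_cons.
Qed.

Lemma h_triple_cons x w :
  h_triple (x :: w) = triple_mul (Some x, Some x, false) (h_triple w).
Proof.
rewrite /h_triple has_ba_cons lst_letter_cons /triple_mul /=.
by congr (_, _, _); [case: lst_letter | rewrite orbC; case: x].
Qed.

Lemma attained_letter x : attained (Some x, Some x, false).
Proof. by case: x. Qed.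

Definition letter_fstlstba x : fstlstba :=
  exist _ (Some x, Some x, false) (attained_letter x).

Lemma attained_h_triple w : attained (h_triple w).
Proof.
elim: w => // x w IHw; rewrite h_triple_cons.
exact: (triple_mul_attained (letter_fstlstba x) (exist _ (h_triple w) IHw)).
Qed.

Definition h0 (w : word letter) : fstlstba :=
  exist _ (h_triple w) (attained_h_triple w).

Lemma h0_monoid_morphism : monoid_morphism h0.
Proof.
have h01 : h0 [::] = 1%g by exact: val_inj.
have h0S x w : h0 (x :: w) = (letter_fstlstba x * h0 w)%g.
  by apply: val_inj; exact: h_triple_cons.
split=> // v w; elim: v => [|x v IHv]; first by rewrite h01 !mul1g.
by rewrite [LHS](h0S x (v ++ w)) h0S -mulgA -IHv.
Qed.

HB.instance Definition _ :=
  isUMagmaMorphism.Build (word letter) fstlstba h0 h0_monoid_morphism.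

Lemma h0_surj (t : fstlstba) : exists w, h0 w = t.
Proof.
suff [w e] : exists w, h_triple w = val t by exists w; exact: val_inj.
case: t => -[[[[]|] [[]|]] []] //= _.
- by exists [:: a; b; a].
- by exists [:: a].
- by exists [:: a; b; a; b].
- by exists [:: a; b].
- by exists [:: b; a].
- by exists [:: b; a; b].
- by exists [:: b].
- by exists [::].
Qed.

(* Main.v *)
Require Import Defs.
From mathcomp Require Import all_boot all_order all_algebra.
From mathcomp Require Import boolp classical_sets cardinality constructive_ereal.
From mathcomp Require Import zify.

(* A factor of a word of L0 is determined, up to the relative congruence, by
   its image under h0 together with the number p of letters a that it lacks on
   the left and the number q of letters b that it lacks on the right. Such a
   class splits into two nonunit classes as soon as p > [first letter is b] or
   q > [last letter is a]. This leaves the classes of a, b, ab, abab, ba, aba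
   and bab, each of which has a member that cannot be cut compatibly with any
   cut of the representative. Every product of two or more primes all of whose
   factors of length 2 and 3 are live and nonprime keeps a surplus of lacking
   letters on one side, so it is never prime; hence a valid production has
   length at most 3, and the finitely many candidates are counted. *)

Local Open Scope classical_set_scope.
Local Open Scope card_scope.

(** * Profiles and their product *)

(* [h_triple w] and the pair of the number of letters a lacking on the left of
   [w] and of letters b lacking on its right; [None] marks a dead word. *)
Definition profile_type : Type := (triple * option (nat * nat))%type.

(* The q letters b lacking on the right of s cancel against the p letters a
   lacking on the left of t. An excess must be supplied across the other word,
   which a factor ba blocks; if ba arises at the junction, nothing may lack. *)
Definition fits (s t : triple) (q p : nat) : bool :=
  if (s.1.2 == Some b) && (t.1.1 == Some a) then (q == 0) && (p == 0)
  else (t.2 ==> (q <= p)) && (s.2 ==> (p <= q)).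

Definition pmul (s t : profile_type) : profile_type :=
  (triple_mul s.1 t.1,
   if (s.2, t.2) is (Some (p1, q1), Some (p2, q2)) then
     if fits s.1 t.1 q1 p2 then Some (p1 + (p2 - q1), q2 + (q1 - p2)) else None
   else None).

Definition pletter (x : letter) : profile_type :=
  ((Some x, Some x, false), Some (if x is a then (0, 1) else (1, 0))).

Definition profile (w : word letter) : profile_type :=
  foldr (fun x => pmul (pletter x)) ((None, None, false), Some (0, 0)) w.

Lemma profile1 w : (profile w).1 = h_triple w.
Proof. by elim: w => // x w IHw; rewrite h_triple_cons -IHw. Qed.

Lemma pmul1 s : pmul ((None, None, false), Some (0, 0)) s = s.
Proof.
case: s => -[[f l] c] [[p q]|]; rewrite /pmul /fits /triple_mul /= orbF;
  last by case: l.
by rewrite leq0n implybT /= subn0 addn0; case: l.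
Qed.

(* The letter is glued to a nonempty word: the empty triple with a nonzero
   deficit is a junk profile on which associativity fails. *)
Lemma pmulA x s t : attained s.1 -> s.1.1.1 != None -> attained t.1 ->
  pmul (pletter x) (pmul s t) = pmul (pmul (pletter x) s) t.
Proof.
have mulA : attained s.1 -> attained t.1 ->
    triple_mul (pletter x).1 (triple_mul s.1 t.1) =
    triple_mul (triple_mul (pletter x).1 s.1) t.1.
  case: s t => -[[f l] c] ? [[[f' l'] c'] ?].
  by case: x f l c f' l' c' => [] [[]|] [[]|] [] //= [[]|] [[]|] [].
move=> As s0 At; rewrite /pmul mulA //; congr (_, _).
case: s t As s0 At {mulA} => -[[f l] c] [[p q]|] [[[f' l'] c'] [[p' q']|]];
  move=> As s0 At; rewrite /fits //=; last 3 first.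
- by case: x; case: ifP.
- by case: x.
- by case: x.
case: x f l c f' l' c' As s0 At =>
  [] [[]|] [[]|] [] //= [[]|] [[]|] [] //= _ _ _.
all: rewrite /= ?implybT ?implybF ?andbT ?andbF.
all: repeat (case: ifP => //= ?); by [exfalso; lia | congr (Some (_, _)); lia].
Qed.

Lemma profile_cat v w : profile (v ++ w) = pmul (profile v) (profile w).
Proof.
elim: v => [|x [|y v] IHv]; first by rewrite pmul1.
  by case: x {IHv}.
rewrite [LHS]/(pmul (pletter x) (profile ((y :: v) ++ w))) IHv.
by apply: pmulA; rewrite profile1 // attained_h_triple.
Qed.

(** * Words of [L0], blocks a^i b^j and arches *)

Lemma L0_nil : L0 [::].
Proof. by exists [::]. Qed.

Lemma L0_cat v w : L0 v -> L0 w -> L0 (v ++ w).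
Proof.
move=> [s Ls <-] [t Lt <-]; exists (s ++ t); last by rewrite flatten_cat.
by move=> u; rewrite mem_cat => /orP[/Ls|/Lt].
Qed.

Lemma L0_anbn n : L0 (nseq n a ++ nseq n b).
Proof.
exists [:: nseq n a ++ nseq n b]; last by rewrite /= cats0.
by move=> w; rewrite inE => /eqP ->; exists n.
Qed.

Lemma profile_nseqa n : profile (nseq n a) =
  (if n == 0 then (None, None, false) else (Some a, Some a, false),
   Some (0, n)).
Proof.
elim: n => // n IHn.
rewrite [LHS]/(pmul (pletter a) (profile (nseq n a))) IHn.
case: n {IHn} => // n;
  by rewrite /pmul /fits /triple_mul /= ?subn0 ?addn1 ?add1n.
Qed.

Lemma profile_nseqb n : profile (nseq n b) =
  (if n == 0 then (None, None, false) else (Some b, Some b, false),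
   Some (n, 0)).
Proof.
elim: n => // n IHn.
rewrite [LHS]/(pmul (pletter b) (profile (nseq n b))) IHn.
case: n {IHn} => // n;
  by rewrite /pmul /fits /triple_mul /= ?subn0 ?addn1 ?add1n.
Qed.

Lemma profile_ab i j : profile (nseq i a ++ nseq j b) =
  (if i == 0 then if j == 0 then None else Some b else Some a,
   if j == 0 then if i == 0 then None else Some a else Some b, false,
   Some (j - i, i - j)).
Proof.
rewrite profile_cat profile_nseqa profile_nseqb.
by case: i j => [|i] [|j]; rewrite /pmul /fits /triple_mul /= ?subn0 ?addn0.
Qed.

(** Where two nonempty balanced blocks meet, a factor ba arises and nothing lacks on either side,
    which [fits] accepts. The empty word stands apart because its triple has no letters. *)
Lemma profile_L0 w : L0 w ->
  w = [::] \/ exists c, profile w = (Some a, Some b, c, Some (0, 0)).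
Proof.
move=> [s + <-]; elim: s => [|u s IHs] Ls; first by left.
have /IHs {IHs}IHs v : v \in s -> anbn v.
  by move=> vs; apply: Ls; rewrite inE vs orbT.
have [n _ <-] : anbn u by apply: Ls; rewrite inE eqxx.
case: n => [|n]; first exact: IHs.
right; suff [c E] : exists c, pmul (profile (nseq n.+1 a ++ nseq n.+1 b))
    (profile (flatten s)) = (Some a, Some b, c, Some (0, 0)).
  by exists c; rewrite -E; exact: profile_cat.
rewrite profile_ab.
case: IHs => [->|[c ->]]; rewrite /pmul /fits /triple_mul /= !subnn.
  by exists false.
by exists true; rewrite orbT.
Qed.

(** Normal form of a live word with a factor ba: a first block lacking j - i letters a, a middle
    from [L0], and a last block lacking k - l letters b. The bounds 0 < j and 0 < k in [archable]
    force the factor ba. *)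
Definition arch (i j : nat) (m : word letter) (k l : nat) : word letter :=
  nseq i a ++ nseq j b ++ m ++ nseq k a ++ nseq l b.

Definition archable i j m k l := [/\ 0 < j, i <= j, L0 m, 0 < k & l <= k].

Lemma profile_arch i j m k l : archable i j m k l ->
  profile (arch i j m k l) =
  (Some (if i == 0 then b else a), Some (if l == 0 then a else b), true,
   Some (j - i, k - l)).
Proof.
move=> [j0 ij /profile_L0 Lm k0 lk].
rewrite /arch catA (profile_cat (_ ++ _)) (profile_cat m).
rewrite !profile_ab -(subnKC ij) -(subnKC lk).
have -> : i - (i + (j - i)) = 0 by lia.
have -> : l - (l + (k - l)) = 0 by lia.
rewrite !addKn !subnKC //.
case: j j0 ij => // j _ ij; case: k k0 lk => // k _ lk.
by case: Lm => [->|[c ->]]; case: i ij => [|i] ij; case: l lk => [|l] lk;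
  rewrite /pmul /fits /triple_mul /= ?implybT ?orbT /= ?subn0 ?addn0 ?add0n.
Qed.

(** * Normal forms of live words *)

Lemma profile_dead v : (profile v).2 = None ->
  forall u w, (profile (u ++ v ++ w)).2 = None.
Proof.
by move=> e u w; rewrite !profile_cat /= e; case: (profile u).2 => // -[].
Qed.

Lemma no_baP w : ~~ has_ba w -> exists i j, w = nseq i a ++ nseq j b.
Proof.
elim: w => [|x w IHw]; first by exists 0, 0.
rewrite has_ba_cons negb_or => /andP[xw /IHw [i [j e]]].
case: x xw => xw; first by exists i.+1, j; rewrite e.
by case: i e xw => [|i] ->; [exists 0, j.+1 | ].
Qed.

Lemma archP w p q : has_ba w -> (profile w).2 = Some (p, q) ->
  exists i j m k l, archable i j m k l /\ w = arch i j m k l.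
Proof.
elim: w p q => // x w IHw p q; rewrite has_ba_cons => baw.
rewrite [profile _]/(pmul (pletter x) (profile w)).
case E : (profile w).2 => [[p' q']|]; last by case: x {baw}.
rewrite profile1 /fits /h_triple /=.
have [wba|/[dup] wba /no_baP[i [j]]] := boolP (has_ba w).
  have [i [j [m [k [l [A we]]]]]] := IHw _ _ wba E.
  have := E; rewrite we profile_arch // => -[e1 e2].
  case: A => j0 ij Lm k0 lk.
  case: x {baw} => /=.
    case: ifP => // p'0 _.
    by exists i.+1, j, m, k, l; split=> //; split=> //; lia.
  case: i ij e1 we => [|i] ij e1 we /=.
    by move=> _; exists 0, j.+1, m, k, l.
  (* A letter b meets a leading a: nothing may lack at this junction, so the first block is balanced
     and joins the middle. *)
  case: ifP => // /eqP p'0 _.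
  exists 0, 1, (nseq i.+1 a ++ nseq j b ++ m), k, l; split.
    split=> //; rewrite catA; apply: L0_cat => //.
    have -> : j = i.+1 by lia.
    exact: L0_anbn.
  by rewrite /arch /= -!catA.
move=> we; move: baw; rewrite (negbTE wba) orbF => /andP[/eqP -> fw].
rewrite fw /=; case: ifP => // /eqP p'0 _.
move: E; rewrite we profile_ab p'0 => -[ij _].
exists 0, 1, [::], i, j; split.
  split=> //; [exact: L0_nil| | lia].
  by move: fw; rewrite we; case: i {we ij} => //; case: j.
by [].
Qed.

(** Zero deficits balance both outer blocks of an arch, which is then a product of words of [L0]; a
    word a^i b^j without ba gets i = j. *)
Lemma L0P w : L0 w <-> (profile w).2 = Some (0, 0).
Proof.
split=> [/profile_L0[->|[c ->]]//|].
have [wba E|/no_baP[i [j ->]]] := boolP (has_ba w).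
  have [i [j [m [k [l [A we]]]]]] := archP _ _ _ wba E.
  move: E; rewrite we profile_arch // => -[ij kl].
  case: A => _ ij' Lm _ kl'.
  have -> : j = i by lia.
  have -> : k = l by lia.
  rewrite /arch catA; apply: L0_cat; first exact: L0_anbn.
  by apply: L0_cat => //; exact: L0_anbn.
rewrite profile_ab => -[ij ji].
have -> : i = j by lia.
exact: L0_anbn.
Qed.

(** * Profiles as a complete invariant of the relative congruence *)

(** The factor ba separates the two sides, so each deficit must be supplied exactly, on its own
    side. *)
Lemma contexts_ba w p q p' q' : has_ba w -> (profile w).2 = Some (p, q) ->
  contexts L0 w (nseq p' a, nseq q' b) <-> (p', q') = (p, q).
Proof.
move=> wba E; rewrite /contexts /= L0P.
have wE : profile w = (fst_letter w, lst_letter w, true, Some (p, q)).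
  by rewrite -E [LHS]surjective_pairing profile1 /h_triple wba.
rewrite !profile_cat profile_nseqa profile_nseqb wE /pmul /fits /triple_mul.
case: p' q' => [|p'] [|q'] /=; rewrite ?implybT ?andbF /= ?leq0n ?andbT;
  split=> [|[? ?]]; repeat case: ifP => ? //=;
  solve [ by move=> [? ?]; congr (_, _); lia
        | by congr (Some (_, _)); lia
        | lia].
Qed.

(** Without ba the supplies on the two sides compensate each other, and only p - q is determined. *)
Lemma contexts_no_ba i j p q :
  contexts L0 (nseq i a ++ nseq j b) (nseq p a, nseq q b) <-> p + i = j + q.
Proof.
rewrite /contexts /= L0P.
have -> : nseq p a ++ (nseq i a ++ nseq j b) ++ nseq q b =
          nseq (p + i) a ++ nseq (j + q) b by rewrite !nseqD !catA.
by rewrite profile_ab; split=> [[? ?]|->]; [lia | rewrite subnn].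
Qed.

Lemma contexts_deficit w p q : (profile w).2 = Some (p, q) ->
  contexts L0 w (nseq p a, nseq q b).
Proof.
have [wba E|/no_baP[i [j ->]]] := boolP (has_ba w).
  exact/(contexts_ba _ _ _ _ _ wba E).
by rewrite profile_ab contexts_no_ba => -[? ?]; lia.
Qed.

Lemma contexts_dead w : (profile w).2 = None -> contexts L0 w = set0.
Proof.
move=> e; apply/seteqP; split=> // -[u v].
by rewrite /contexts /= L0P profile_dead.
Qed.

(** Profiles multiply and detect [L0], so they determine all contexts. Conversely [h0] gives the
    triple, and the contexts (a^p, b^q) recover the deficits. *)
Lemma releq_profile x y : releq L0 h0 x y <-> profile x = profile y.
Proof.
split=> [[cxy /(congr1 val) /= hxy]|xy]; last first.
  split; last by apply: val_inj; rewrite /= -!profile1 xy.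
  by apply/seteqP; split=> -[u v]; rewrite /contexts /= !L0P !profile_cat xy.
rewrite [LHS]surjective_pairing [RHS]surjective_pairing !profile1 hxy.
congr (_, _).
case Ex : (profile x).2 => [[p q]|]; last first.
  case Ey : (profile y).2 => [[p q]|] //.
  by have := contexts_deficit _ _ _ Ey; rewrite -cxy contexts_dead.
have := contexts_deficit _ _ _ Ex; rewrite cxy.
case Ey : (profile y).2 => [[p' q']|]; last by rewrite contexts_dead.
case: hxy => _ _; have [xba yba|xba /esym/negbT yba] := boolP (has_ba x).
  by rewrite (contexts_ba _ _ _ _ _ _ Ey) // => ->.
(* Only the difference of the exponents is read off, but it fixes both deficits, which are its two
   truncations. *)
have [i [j xE]] := no_baP _ xba; have [i' [j' yE]] := no_baP _ yba.
move: Ex Ey; rewrite xE yE !profile_ab contexts_no_ba => -[<- <-] [<- <-] ?.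
by congr (Some (_, _)); lia.
Qed.

(** * Criteria for primality *)

Notation cls := (relclass L0 h0).

Lemma clsP x y : cls x = cls y <-> profile x = profile y.
Proof. by rewrite relclass_eqP releq_profile. Qed.

(** Only the empty word has no first letter, so the unit class is a singleton. *)
Lemma profile_nil x : profile x = profile [::] -> x = [::].
Proof. by case: x => // -[] x /(congr1 (fun s => s.1.1.1)). Qed.

Lemma liveP z : live L0 (cls z) <-> (profile z).2 <> None.
Proof.
split=> [/(_ z)|lz x /releq_profile zx].
  by move=> + e; rewrite contexts_dead // => -[]// [].
case E : (profile x).2 => [[p q]|]; last by rewrite zx in lz.
by exists (nseq p a, nseq q b); exact: contexts_deficit.
Qed.

Lemma prime_split z x y : relprime L0 h0 (cls z) ->
  profile (x ++ y) = profile z ->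
  (forall w, profile w = profile z -> exists x' y',
     [/\ w = x' ++ y', profile x' = profile x & profile y' = profile y]) ->
  x = [::] \/ y = [::].
Proof.
move=> [_ _ _ /(_ (cls x) (cls y))] + xyz zw.
case; try by eexists.
- apply/seteqP; split=> w.
    move=> /releq_profile/esym /zw[x' [y' [-> ex ey]]].
    by exists x'; [apply/releq_profile | exists y'; [apply/releq_profile|]].
  move=> [x' /releq_profile ex [y' /releq_profile ey <-]].
  by apply/releq_profile; rewrite profile_cat -ex -ey -profile_cat.
- by move/clsP/profile_nil; left.
- by move/clsP/profile_nil; right.
Qed.

Definition no_cut (r w : word letter) : bool :=
  (profile w == profile r) &&
  all (fun i => all (fun k => ~~ ((profile (take k w) == profile (take i r)) &&
                                  (profile (drop k w) == profile (drop i r))))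
                    (iota 0 (size w).+1))
      (iota 1 (size r).-1).

Lemma setprod_cls (x y w : word letter) : setprod (cls x) (cls y) w ->
  exists x' y' : word letter,
    [/\ w = x' ++ y', profile x' = profile x & profile y' = profile y].
Proof.
by move=> [x' /releq_profile ex [y' /releq_profile ey <-]]; exists x', y'.
Qed.

(** If the class is X·Y, both [r] and [w] cut into a member of X and a member of Y, so these cuts
    have matching profiles. By [no_cut] the cut of [r] is then trivial, and its empty part makes X
    or Y the unit class. *)
Lemma no_cut_prime r w : r != [::] -> (profile r).2 != None -> no_cut r w ->
  relprime L0 h0 (cls r).
Proof.
move=> r0 lr /andP[/eqP wr /allP rw]; split; first by exists r.
- exact/liveP/eqP.
- by move=> /clsP/profile_nil; exact/eqP.
move=> _ _ [x _ <-] [y _ <-] xyE.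
have : cls r r by exact/releq_profile.
rewrite xyE => /setprod_cls[x' [y' [rE xx' yy']]].
have : cls r w by exact/releq_profile.
rewrite xyE => /setprod_cls[x'' [y'' [wE xx'' yy'']]].
rewrite /unit_class.
have [/eqP x0|x0] := boolP (size x' == 0).
  by left; apply/clsP; rewrite -xx' (size0nil x0).
have [/eqP y0|y0] := boolP (size y' == 0).
  by right; apply/clsP; rewrite -yy' (size0nil y0).
have /rw /allP /(_ (size x'')) : size x' \in iota 1 (size r).-1.
  by rewrite mem_iota rE (@size_cat letter); lia.
rewrite mem_iota rE wE !take_size_cat // !drop_size_cat // size_cat.
by rewrite xx' yy' xx'' yy'' !eqxx ltnS leq_addr => /(_ isT).
Qed.

(** * The seven primes *)

Definition reps : seq (word letter) :=
  [:: [:: a]; [:: b]; [:: a; b]; [:: a; b; a; b]; [:: b; a]; [:: a; b; a];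
      [:: b; a; b]].

(** A letter has no proper cut and serves itself. For ba the only proper cut is b|a, while each
    proper cut of baba leaves a factor ba on some side; the other witnesses block all cuts in a like
    way. *)
Definition witness (r : word letter) : word letter :=
  if r == [:: a; b] then [:: a; a; b; b] else
  if r == [:: a; b; a; b] then [:: a; a; b; b; a; b; a; a; b; b] else
  if r == [:: b; a] then [:: b; a; b; a] else
  if r == [:: a; b; a] then [:: a; a; b; b; a; b; a] else
  if r == [:: b; a; b] then [:: b; a; b; a; a; b; b] else r.

Lemma reps_prime (r : word letter) : r \in reps -> relprime L0 h0 (cls r).
Proof.
move=> rr; suff /and3P[r0 lr] : [&& r != [::], (profile r).2 != None &
    no_cut r (witness r)] by exact: no_cut_prime.
by move: r rr; apply/allP; vm_compute.
Qed.

Definition primeb (z : word letter) : bool :=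
  profile z \in [seq profile r | r <- reps].

(** * No other class is prime *)

Lemma profile_ab_eq i j i' j' :
  profile (nseq i a ++ nseq j b) = profile (nseq i' a ++ nseq j' b) <->
  [/\ (i == 0) = (i' == 0), (j == 0) = (j' == 0) & i + j' = i' + j].
Proof.
rewrite !profile_ab; case: i j i' j' => [|i] [|j] [|i'] [|j'] /=.
all: split=> [E|[//= *]]; first by split=> //; case: E => // *; lia.
all: by congr (_, Some (_, _)); lia.
Qed.

Lemma profile_arch_eq i j m k l i' j' m' k' l' :
  archable i j m k l -> archable i' j' m' k' l' ->
  profile (arch i j m k l) = profile (arch i' j' m' k' l') <->
  [/\ (i == 0) = (i' == 0), (l == 0) = (l' == 0), j + i' = j' + i &
      k + l' = k' + l].
Proof.
move=> A A'; rewrite !profile_arch //.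
case: A A' => j0 ij _ k0 lk [j'0 ij' _ k'0 lk'].
split.
  by case: i l i' l' ij lk ij' lk' => [|i] [|l] [|i'] [|l'] //= *; 
    match goal with H : _ = _ |- _ => case: H => * end; split=> //; lia.
move=> [-> -> ? ?]; congr (_, Some (_, _)); lia.
Qed.

Lemma profile_has_ba z w : profile w = profile z -> has_ba w = has_ba z.
Proof. by move=> /(congr1 (fun s => s.1.2)); rewrite !profile1. Qed.

Lemma has_ba_ab i j : has_ba (nseq i a ++ nseq j b) = false.
Proof.
by have := congr1 (fun s => s.1.2) (profile_ab i j); rewrite profile1.
Qed.

Lemma profile_ab_inv i j w : profile w = profile (nseq i a ++ nseq j b) ->
  exists i' j', [/\ w = nseq i' a ++ nseq j' b, (i' == 0) = (i == 0),
    (j' == 0) = (j == 0) & i' + j = i + j'].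
Proof.
move=> /[dup] /profile_has_ba; rewrite has_ba_ab => /negbT/no_baP[i' [j' ->]].
by move=> /profile_ab_eq[? ? ?]; exists i', j'.
Qed.

Lemma profile_arch_inv i j m k l w : archable i j m k l ->
  profile w = profile (arch i j m k l) ->
  exists i' j' m' k' l', [/\ w = arch i' j' m' k' l', archable i' j' m' k' l' &
    [/\ (i' == 0) = (i == 0), (l' == 0) = (l == 0), j' + i = j + i' &
      k' + l = k + l']].
Proof.
move=> A wz.
have wba : has_ba w.
  by have := congr1 (fun s => s.1.2) wz; rewrite profile1 profile_arch.
have /(archP _ _ _ wba) [i' [j' [m' [k' [l' [A' we]]]]]] :
    (profile w).2 = Some (j - i, k - l) by rewrite wz profile_arch.
exists i', j', m', k', l'; split=> //.
by apply/profile_arch_eq => //; [exact: A'|exact: A|]; rewrite -we.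
Qed.

(** If i > j and i > 1, every member is a followed by a word of one fixed class; if j > i and j > 1,
    a final b splits off likewise. Equal exponents give the class of ab or the unit. *)
Lemma prime_ab i j : relprime L0 h0 (cls (nseq i a ++ nseq j b)) ->
  primeb (nseq i a ++ nseq j b).
Proof.
have [ij|ij|->] := ltngtP i j => zP; last first.
- case: j zP => [[_ _ z0 _]|j _]; first by case: z0.
  by rewrite /primeb profile_ab subnn.
- case: i ij zP => [|[|i]] //; first by rewrite ltnS leqn0 => /eqP ->.
  move=> ij zP; case: (prime_split _ [:: a] (nseq i.+1 a ++ nseq j b) zP) => //.
  move=> w /profile_ab_inv[[|i'] [j' [-> ? ? ?]]]; first lia.
  exists [:: a], (nseq i' a ++ nseq j' b); split=> //.
  by apply/profile_ab_eq; split; lia.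
- case: j ij zP => [|[|j]] //; first by rewrite ltnS leqn0 => /eqP ->.
  have bE n : nseq n.+1 b = nseq n b ++ [:: b] by rewrite -(nseqD n 1) addn1.
  move=> ij zP.
  case: (prime_split _ (nseq i a ++ nseq j.+1 b) [:: b] zP) => //.
  + by rewrite -catA -bE.
  + move=> w /profile_ab_inv[i' [[|j'] [-> ? ? ?]]]; first lia.
    exists (nseq i' a ++ nseq j' b), [:: b]; rewrite bE catA; split=> //.
    by apply/profile_ab_eq; split; lia.
  + by case: i {ij zP}.
Qed.

Lemma arch_catl i j j' m k l :
  (nseq i a ++ nseq j b) ++ arch 0 j' m k l = arch i (j + j') m k l.
Proof. by rewrite /arch nseqD -!catA. Qed.

Lemma arch_catr i j m k k' l :
  arch i j m k 0 ++ (nseq k' a ++ nseq l b) = arch i j m (k + k') l.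
Proof. by rewrite /arch nseqD cats0 -!catA. Qed.

(** If j exceeds i + (i == 0), every member splits after an initial block of the class of ab or b;
    symmetrically, a final block of the class of ab or a splits off on the right. The minimal j and
    k leave ba, aba, bab and abab. *)
Lemma prime_arch i j m k l : archable i j m k l ->
  relprime L0 h0 (cls (arch i j m k l)) -> primeb (arch i j m k l).
Proof.
move=> /[dup] A [j0 ij Lm k0 lk] zP.
have jE : j = i + (i == 0).
  apply/eqP; rewrite eqn_leq; apply/andP; split; last first.
    by case: i ij {A zP} => //=; lia.
  rewrite leqNgt; apply/negP => ltj.
  case: (prime_split _ (nseq i a ++ nseq (i + (i == 0)) b)
    (arch 0 (j - i - (i == 0)) m k l) zP).
  - rewrite arch_catl.
    by have -> : i + (i == 0) + (j - i - (i == 0)) = j by lia.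
  - move=> w /(profile_arch_inv _ _ _ _ _ _ A).
    move=> [i' [j' [m' [k' [l' [-> [? ? ? ? ?] [? ? ? ?]]]]]]].
    exists (nseq i' a ++ nseq (i' + (i' == 0)) b),
      (arch 0 (j' - i' - (i' == 0)) m' k' l'); split.
    + rewrite arch_catl.
      by have -> : i' + (i' == 0) + (j' - i' - (i' == 0)) = j' by lia.
    + by apply/profile_ab_eq; split; lia.
    + by apply/profile_arch_eq; split=> //; lia.
  - by case: i {ij A zP ltj}.
  - have : 0 < j - i - (i == 0) by lia.
    by rewrite /arch; case: (j - i - _).
have kE : k = l + (l == 0).
  apply/eqP; rewrite eqn_leq; apply/andP; split; last first.
    by case: l lk {A zP} => //=; lia.
  rewrite leqNgt; apply/negP => ltk.
  case: (prime_split _ (arch i j m (k - l - (l == 0)) 0)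
    (nseq (l + (l == 0)) a ++ nseq l b) zP).
  - rewrite arch_catr.
    by have -> : k - l - (l == 0) + (l + (l == 0)) = k by lia.
  - move=> w /(profile_arch_inv _ _ _ _ _ _ A).
    move=> [i' [j' [m' [k' [l' [-> [? ? ? ? ?] [? ? ? ?]]]]]]].
    exists (arch i' j' m' (k' - l' - (l' == 0)) 0),
      (nseq (l' + (l' == 0)) a ++ nseq l' b); split.
    + rewrite arch_catr.
      by have -> : k' - l' - (l' == 0) + (l' + (l' == 0)) = k' by lia.
    + by apply/profile_arch_eq; split=> //; lia.
    + by apply/profile_ab_eq; split; lia.
  - by rewrite /arch; case: i {A zP ij jE} => //; case: j j0.
  - by case: l {A zP lk ltk}.
rewrite /primeb profile_arch // jE kE !addKn.
by case: (i == 0); case: (l == 0).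
Qed.

Lemma relprime_clsP z : relprime L0 h0 (cls z) <-> primeb z.
Proof.
split=> [zP|/mapP[r rr /clsP ->]]; last exact: reps_prime.
have [zba|/no_baP[i [j zE]]] := boolP (has_ba z); last first.
  by rewrite zE in zP *; exact: prime_ab.
have [_ /liveP + _ _] := zP.
case E : (profile z).2 => [[p q]|] // _.
have [i [j [m [k [l [A zE]]]]]] := archP _ _ _ zba E.
by rewrite zE in zP *; exact: prime_arch.
Qed.

(** * Productions as sequences of representatives *)

Lemma quoprods_cls (ws : seq (word letter)) :
  quoprods L0 h0 (map cls ws) = cls (flatten ws).
Proof.
by elim: ws => //= w ws; rewrite /quoprods /= => ->; rewrite quoprodE.
Qed.

Definition pleonasticb (ws : seq (word letter)) : bool :=
  has (fun i => has (fun j =>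
      let s := take j (drop i ws) in
      [&& 2 <= size s, size s < size ws & primeb (flatten s)])
    (iota 0 (size ws).+1)) (iota 0 (size ws).+1).

Lemma pleonasticP (ws : seq (word letter)) :
  pleonastic L0 h0 (map cls ws) <-> pleonasticb ws.
Proof.
split=> [[s1 [s2 [s3 [e s2_2 s2_lt s2P]]]]|].
  have sz : size ws = size s1 + (size s2 + size s3).
    by rewrite -!size_cat -e size_map.
  have [t tE s2E] : exists2 t, take (size s2) (drop (size s1) ws) = t &
      s2 = map cls t.
    by eexists; rewrite // map_take map_drop e drop_size_cat // take_size_cat.
  apply/hasP; exists (size s1); first by rewrite mem_iota; lia.
  apply/hasP; exists (size s2); first by rewrite mem_iota; lia.
  move: s2P s2_2 s2_lt; rewrite tE s2E quoprods_cls !size_map.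
  by move=> /relprime_clsP tP t2 tlt; apply/and3P.
move=> /hasP[i _ /hasP[j _ /and3P[s2 slt sP]]].
exists (map cls (take i ws)), (map cls (take j (drop i ws))),
  (map cls (drop j (drop i ws))).
rewrite -!map_cat !cat_take_drop quoprods_cls !size_map; split=> //.
exact/relprime_clsP.
Qed.

Definition validb (ws : seq (word letter)) : bool :=
  [&& 1 < size ws, all [in reps] ws, primeb (flatten ws) & ~~ pleonasticb ws].

(** Correctness fixes the left-hand side as the product of the right-hand side, so the sequence
    encodes the whole production. *)
Definition prod_of (ws : seq (word letter)) : production letter :=
  (cls (flatten ws), map cls ws).

Lemma relprimeP P : relprime L0 h0 P <-> exists2 r, r \in reps & P = cls r.
Proof.
split=> [|[r rr ->]]; last exact: reps_prime.
move=> /[dup] -[[z _ <-] _ _ _] /relprime_clsP /mapP[r rr /clsP zr].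
by exists r.
Qed.

Lemma relprimes_map (s : seq (set (word letter))) :
  (forall Q, Q \in s -> relprime L0 h0 Q) ->
  exists2 ws, all [in reps] ws & s = map cls ws.
Proof.
elim: s => [|P s IHs] sP; first by exists [::].
have [|ws wsr ->] := IHs; first by move=> Q Qs; apply: sP; rewrite inE Qs orbT.
have [|r rr ->] := (relprimeP P).1; first by apply: sP; rewrite inE eqxx.
by exists (r :: ws) => //=; rewrite rr.
Qed.

Lemma validP p : valid L0 h0 p <-> exists2 ws, validb ws & p = prod_of ws.
Proof.
case: p => P s; split=> [[[/= Pp /relprimes_map[ws wsr ->] s2 sE] npl]|[ws]].
  move: sE s2 npl; rewrite quoprods_cls size_map pleonasticP => sE s2 /negP npl.
  exists ws; last by rewrite /prod_of sE.
  by rewrite /validb s2 wsr npl andbT; apply/relprime_clsP; rewrite sE.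
move=> /and4P[s2 /allP wsr wsP /negP npl] -> /=; split; last first.
  by rewrite pleonasticP.
split=> /=; [exact/relprime_clsP | | by rewrite size_map | exact: quoprods_cls].
by move=> Q /mapP[r /wsr rr ->]; exact: reps_prime.
Qed.

(** * Valid productions have length at most 3 *)

Definition nonprime (z : word letter) : bool :=
  ((profile z).2 != None) && ~~ primeb z.

(* For a product of profile s that begins with the prime of r: on which side too
   many letters lack for s to be prime depends on r. The products beginning
   with abab or bab already have a prime or dead factor of length 2. *)
Definition surplus (r : word letter) (s : profile_type) : bool :=
  let: (f, l, c, d) := s in
  if d is Some (p, q) then
    let right_surplus := (1 < q) || (0 < q) && (l == Some b) in
    if r == [:: b] then (f == Some b) && (1 < p)
    else if r == [:: a; b] then (f == Some a) && (0 < p)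
    else if r == [:: a] then [&& f == Some a, ~~ c, p == 0 & right_surplus]
    else if r == [:: b; a] then [&& f == Some b, c, p == 1 & right_surplus]
    else if r == [:: a; b; a] then [&& f == Some a, c, p == 0 & right_surplus]
    else false
  else false.

Lemma surplus_nonprime x z : x \in reps -> surplus x (profile z) -> ~~ primeb z.
Proof.
move=> xr zs; apply/negP => /mapP[r rr e]; rewrite e in zs.
have /allP/(_ _ rr)/allP/(_ _ xr)/negP :
  all (fun r => all (fun x => ~~ surplus x (profile r)) reps) reps.
  by vm_compute.
exact.
Qed.

Lemma surplus2 x y : x \in reps -> y \in reps -> nonprime (x ++ y) ->
  surplus x (profile (x ++ y)).
Proof.
move=> xr yr; apply: implyP; move: y yr; apply/allP; move: x xr; apply/allP.
by vm_compute.
Qed.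

(** These contain every pair of primes that extends to a triple whose blocks of length 2 and 3 are
    all live and nonprime. *)
Definition steps : seq (word letter * word letter) :=
  [:: ([:: a], [:: a]); ([:: b], [:: b]); ([:: b], [:: b; a]);
      ([:: a; b], [:: b]); ([:: a; b], [:: b; a]); ([:: b; a], [:: a]);
      ([:: a; b; a], [:: a])].

Lemma nonprime3_step x y z : x \in reps -> y \in reps -> z \in reps ->
  nonprime (x ++ y) -> nonprime (y ++ z) -> nonprime (x ++ y ++ z) ->
  (x, y) \in steps.
Proof.
move=> xr yr zr xy yz xyz.
have /allP/(_ _ xr)/allP/(_ _ yr)/allP/(_ _ zr)/implyP : all (fun x => all
    (fun y => all (fun z =>
      [&& nonprime (x ++ y), nonprime (y ++ z) & nonprime (x ++ y ++ z)] ==>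
      ((x, y) \in steps)) reps) reps) reps by vm_compute.
by apply; exact/and3P.
Qed.

(** Prepending a, ba or aba keeps a surplus on the right, and prepending b or ab keeps one on the
    left. Before ba, the letter a that ba lacks already gives b and ab their left surplus. *)
Lemma surplus_step x y s : (x, y) \in steps -> surplus y s ->
  surplus x (pmul (profile x) s).
Proof.
case: s => -[[f l] c] [[p q]|]; last by rewrite /surplus.
rewrite !inE => /or4P[|||/or4P[|||]] /eqP[-> ->].
all: case: f l c => [[]|] [[]|] [] //=; rewrite /pmul /fits /triple_mul /= => H.
all: by try (case: ifP => ?); lia.
Qed.

(** A dead block would kill the product, which is prime and hence live; a prime block would make the
    sequence pleonastic. *)
Lemma factor_nonprime (s1 s2 s3 : seq (word letter)) :
  validb (s1 ++ s2 ++ s3) -> 1 < size s2 < size (s1 ++ s2 ++ s3) ->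
  nonprime (flatten s2).
Proof.
move=> /and4P[_ wsr wsP npl] /andP[s2_2 s2_lt]; rewrite /nonprime.
apply/andP; split.
  apply/eqP => e; move: wsP; rewrite !flatten_cat => /mapP[r rr].
  move=> /(congr1 snd); rewrite profile_dead // => re.
  have /allP/(_ _ rr) : all (fun r => (profile r).2 != None) reps by [].
  by rewrite -re.
apply/negP => /relprime_clsP s2P; move/negP: npl; apply; apply/pleonasticP.
exists (map cls s1), (map cls s2), (map cls s3).
by rewrite -!map_cat quoprods_cls !size_map.
Qed.

Lemma validb_size ws : validb ws -> size ws <= 3.
Proof.
move=> wsV; rewrite leqNgt; apply/negP => ws4.
have wsr : all [in reps] ws by case/and4P: wsV.
(* Every suffix of length at least 2 has a surplus, by induction from the right end. As the sequence
   has at least four terms, its blocks of length 2 and 3 are proper. *)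
have sur x y s s1 : ws = s1 ++ [:: x, y & s] ->
    surplus x (profile (flatten [:: x, y & s])).
  elim: s x y s1 => [|z s IHs] x y s1 wsE; move: wsr wsV ws4; rewrite wsE.
    rewrite all_cat /= => /and4P[_ xr yr _] wsV ws4; rewrite /= cats0.
    apply: surplus2 => //.
    have := factor_nonprime s1 [:: x; y] [::] wsV.
    by rewrite /= !cats0; apply; move: ws4; rewrite !size_cat /=; lia.
  rewrite all_cat /= => /and5P[_ xr yr zr _] wsV ws4.
  rewrite profile_cat; apply: surplus_step (IHs y z (rcons s1 x) _).
    apply: (nonprime3_step _ _ z) => //.
    - have := factor_nonprime s1 [:: x; y] (z :: s) wsV.
      by rewrite /= !cats0; apply; move: ws4; rewrite !size_cat /=; lia.
    - have := factor_nonprime (rcons s1 x) [:: y; z] s.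
      rewrite cat_rcons /= !cats0; apply => //.
      by move: ws4; rewrite !size_cat /=; lia.
    - have := factor_nonprime s1 [:: x; y; z] s wsV.
      by rewrite /= !cats0; apply; move: ws4; rewrite !size_cat /=; lia.
  by rewrite cat_rcons.
(* For the whole sequence, the surplus contradicts the primality of the product. *)
case: ws wsV wsr ws4 sur => [|x [|y s]] // /and4P[_ _ wsP _] /andP[xr _] _.
move=> /(_ x y s [::] erefl) /surplus_nonprime -/(_ xr).
by rewrite wsP.
Qed.

(** * Counting primes and valid productions *)

Definition valid_sequences : seq (seq (word letter)) :=
  [seq ws <- [seq [:: x; y] | x <- reps, y <- reps] ++
             [seq x :: ws | x <- reps,
                ws <- [seq [:: y; z] | y <- reps, z <- reps]]
   | validb ws].

Lemma mem_valid_sequences ws : (ws \in valid_sequences) = validb ws.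
Proof.
rewrite mem_filter; case: (boolP (validb ws)) => // /[dup] /validb_size.
case: ws => [|x [|y [|z [|]]]] // _ /and4P[// _ wsr _ _]; rewrite mem_cat.
  by case/and3P: wsr => xr yr _; rewrite allpairs_f.
case/and4P: wsr => xr yr zr _; apply/orP; right.
by apply: allpairs_f => //; exact: allpairs_f.
Qed.

Lemma card_image_seq (T : eqType) (U : Type) (f : T -> U) (s : seq T) :
  uniq s -> {in s &, injective f} -> f @` [set x | x \in s] #= `I_(size s).
Proof.
case: s => [|x0 s] us finj.
  by rewrite (_ : [set x | _] = set0) ?image_set0 ?II0 //; apply/seteqP; split.
have -> : f @` [set x | x \in x0 :: s] =
    (f \o nth x0 (x0 :: s)) @` `I_(size s).+1.
  apply/seteqP; split=> _ [i /= si <-].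
    exists (index i (x0 :: s)); last exact: (congr1 f (nth_index x0 si)).
    by move: si; rewrite -index_mem.
  by exists (nth x0 (x0 :: s) i) => //=; exact: mem_nth.
apply: inj_card_eq => i j; rewrite !inE /= => si sj e.
apply/eqP; rewrite -(nth_uniq x0 _ _ us) //; apply/eqP.
by apply: finj => //; exact: mem_nth.
Qed.

Lemma cls_inj : {in reps &, injective (fun r : word letter => cls r)}.
Proof.
move=> x y xr yr /clsP xy; apply/eqP; move: xy => /eqP; apply: implyP.
by move: y yr; apply/allP; move: x xr; apply/allP; vm_compute.
Qed.

Lemma map_cls_inj ws ws' : all [in reps] ws -> all [in reps] ws' ->
  map cls ws = map cls ws' -> ws = ws'.
Proof.
elim: ws ws' => [|w ws IHws] [|w' ws'] //= /andP[wr wsr] /andP[wr' wsr'] [e es].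
by rewrite (cls_inj _ _ wr wr' e) (IHws ws').
Qed.

(** [supremum] chooses a least upper bound, and a maximum is the only one. *)
Lemma supremum_max d (T : porderType d) (x0 m : T) (A : set T) :
  A m -> ubound A m -> supremum x0 A = m.
Proof.
move=> Am mA; rewrite /supremum; case: eqP => [A0|_]; first by rewrite A0 in Am.
by apply: xget_subset1 (@is_subset1_supremums _ _ A); split=> // y; exact.
Qed.

Theorem theorem9p11 :
  [/\ relprimes L0 h0 #= `I_7,
      valid_productions L0 h0 #= `I_34 &
      validity_radius L0 h0 = (Posz 3)%:E%E].
Proof.
have validE : valid_productions L0 h0 =
    prod_of @` [set ws | ws \in valid_sequences].
  apply/seteqP; split=> p /=.
    by move=> /validP[ws wsV ->]; exists ws => //=; rewrite mem_valid_sequences.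
  move=> [ws /=]; rewrite mem_valid_sequences => wsV <-.
  by apply/validP; exists ws.
split.
- have -> : relprimes L0 h0 = (fun r => cls r) @` [set r | r \in reps].
    apply/seteqP; split=> P /=; first by move=> /relprimeP[r rr ->]; exists r.
    by move=> [r rr <-]; apply/relprimeP; exists r.
  exact: (card_image_seq _ _ _ reps isT cls_inj).
- rewrite validE (_ : 34 = size valid_sequences); last by vm_compute.
  apply: card_image_seq; first by vm_compute.
  (* The right-hand sides alone separate the productions, as the seven classes are distinct. *)
  move=> ws ws'; rewrite !mem_valid_sequences => /and4P[_ wsr _ _].
  by move=> /and4P[_ wsr' _ _] [_]; exact: map_cls_inj.
- apply: supremum_max.
    (* The product aabb lies in the class of ab, while the blocks aab and abb are not prime. *)
    exists (prod_of [:: [:: a]; [:: a; b]; [:: b]]) => //.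
    by rewrite validE; exists [:: [:: a]; [:: a; b]; [:: b]].
  move=> _ [p /validP[ws /validb_size ws3 ->] <-].
  by rewrite /= size_map lee_fin.
Qed.
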